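(* Let $M$ be a connected manifold, let $n$ be the minimum positive integer such that $H_n(M;\mathbb{Z})\neq0$, let $\Omega$ be a closed $n$-form on $M$ whose class $[\Omega]\in H^n(M;\mathbb{R})$ is non-zero and lies in the image of $H^n(M;\mathbb{Z})\to H^n(M;\mathbb{R})$, and let $G=\mathrm{Diff}_\Omega(M)$ be the group of $\Omega$-preserving diffeomorphisms of $M$. Then the group cochains $b_k=\langle\delta\eta_k,\Delta_k\rangle\in C^n_{\mathrm{grp}}(G;S^1)$, $0\le k\le n-1$, are cocycles and are cohomologous to each other. Moreover, the cohomology class $[b_k]\in H^n_{\mathrm{grp}}(G;S^1)$ is independent of the choice of the cochains $\eta_k$ and $\Delta_k$.
   Context: **Group cochains.** For a group $G$ and a $G$-module $A$, $C^p_{\mathrm{grp}}(G;A)$ is the group of all maps $c:G^p\to A$ (with $C^0_{\mathrm{grp}}(G;A)=A$). The coboundary $\delta:C^p_{\mathrm{grp}}(G;A)\to C^{p+1}_{\mathrm{grp}}(G;A)$ is, for $A$ a left $G$-module, $$\delta c(g_1,\dots,g_{p+1})=g_1c(g_2,\dots,g_{p+1})+\sum_{i=1}^p(-1)^ic(g_1,\dots,g_ig_{i+1},\dots,g_{p+1})+(-1)^{p+1}c(g_1,\dots,g_p),$$ and, for $A$ a right $G$-module, $$\delta c(g_1,\dots,g_{p+1})=c(g_2,\dots,g_{p+1})+\sum_{i=1}^p(-1)^ic(g_1,\dots,g_ig_{i+1},\dots,g_{p+1})+(-1)^{p+1}c(g_1,\dots,g_p)g_{p+1}.$$ $H^*_{\mathrm{grp}}(G;A)$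 is the resulting cohomology; $S^1=\mathbb{R}/\mathbb{Z}$ is the trivial $G$-module. **The cochains $b_k$.** $(C_*(M;\mathbb{Z}),\partial)$ is the (smooth) singular chain complex and $(C^*(M;A),d)$ the corresponding singular cochain complex with coefficients in $A\in\{\mathbb{R},S^1\}$, regarded as left $G$-modules (by pushforward) and right $G$-modules (by pullback) respectively. The operators $\partial,d$ act on group cochains by acting on values. Regard $\Omega$ as the singular cocycle $\sigma\mapsto\int_\sigma\Omega$ in $C^n(M;\mathbb{R})$, and let $j:C^*(M;\mathbb{R})\to C^*(M;S^1)$ be reduction mod $\mathbb{Z}$. Choose: - a point $x\in M$ and $\Delta_0=x\in C_0(M;\mathbb{Z})=C^0_{\mathrm{grp}}(G;C_0(M;\mathbb{Z}))$, and $\Delta_k\in C^k_{\mathrm{grp}}(G;C_k(M;\mathbb{Z}))$ for $1\le k\le n$ with $\delta\Delta_k=\partial\Delta_{k+1}$ for $0\le k<n$; - $\eta_{n-1}\in C^{n-1}(M;S^1)=C^0_{\mathrm{grp}}(G;C^{n-1}(M;S^1))$ with $d\eta_{n-1}=j\Omega$, and $\eta_k\in C^{n-1-k}_{\mathrm{grp}}(G;C^k(M;S^1))$ for $0\le k<n-1$ with $\delta\eta_k=-(-1)^{n-k}d\eta_{k-1}$ for $0<k<n$. Such choices exist. The evaluation pairing $C^r(M;S^1)\times C_r(M;\mathbb{Z})\to S^1$ induces $\langle\cdot,\cdot\rangle:C^p_{\mathrm{grp}}(G;C^r(M;S^1))\times C^q_{\mathrm{grp}}(G;C_r(M;\mathbb{Z}))\to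 C^{p+q}_{\mathrm{grp}}(G;S^1)$, $\langle a,b\rangle(g_1,\dots,g_{p+q})=\langle a(g_1,\dots,g_p),b(g_{p+1},\dots,g_{p+q})\rangle$. For $0\le k\le n-1$, $b_k=\langle\delta\eta_k,\Delta_k\rangle$. *)

(* Defs.v *)
From HB Require Import structures.
From mathcomp Require Import freeg.
From mathcomp Require Import all_boot all_order all_algebra.
From mathcomp Require Import all_classical all_reals all_analysis.
Set Implicit Arguments.
Unset Strict Implicit.
Unset Printing Implicit Defensive.
Import Order.TTheory GRing.Theory Num.Theory.
Import numFieldNormedType.Exports.
Local Open Scope classical_set_scope.
Local Open Scope ring_scope.

(* f is of class C^k on U; meaningful for U open. *)
Fixpoint Ck (R : realType) (V W : normedModType R) (k : nat) (U : set V)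
    (f : V -> W) : Prop :=
  if k is k'.+1 then
    (forall x, U x -> differentiable f x) /\ forall v, Ck k' U ('D_v f)
  else forall x, U x -> {for x, continuous f}.

Definition smooth_on (R : realType) (V W : normedModType R) (U : set V)
  (f : V -> W) : Prop := forall k, Ck k U f.

Section Calculus.
Variables (R : realType).
Implicit Types (V W : normedModType R).

Lemma differentiable_near0 V W (h : V -> W) x :
  (\near x, h x = 0) -> differentiable h x.
Proof.
move=> h0; have hx : h x = 0 by exact: nbhs_singleton h0.
have E : h \o shift x = cst (h x) + (\0 : {linear V -> W}) +o_ (0 : V) id.
  apply/eqaddoP => _/posnumP[e]; near=> y; rewrite !fctE /= hx addr0 subr0.
  suff -> : h (y + x) = 0 by rewrite normr0 mulr_ge0.
  near: y; move: h0; rewrite (near_shift 0) /= subr0.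
  by apply: filterS => y /=.
have C : continuous (\0 : {linear V -> W}) by exact: cst_continuous.
by apply/diff_locallyP; rewrite (diff_unique C E); split.
Unshelve. all: by end_near. Qed.

Lemma near_eq_differentiable V W (f g : V -> W) x :
  (\near x, f x = g x) -> differentiable f x -> differentiable g x.
Proof.
move=> fg df; rewrite (_ : g = f + (g - f)); last first.
  by apply/funext => y; rewrite !fctE/= addrC subrK.
apply: (differentiableD df); apply: differentiable_near0.
by apply: filterS fg => y fgy; rewrite !fctE /= fgy subrr.
Qed.

Lemma Ck_ext V W k (U : set V) (f g : V -> W) :
  open U -> (forall x, U x -> f x = g x) -> Ck k U f -> Ck k U g.
Proof.
move=> oU; elim: k f g => [|k IH] f g fg.
  move=> cf x Ux; have n : \near x, f x = g x.
    by apply: filterS fg _; exact: open_nbhs_nbhs.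
  have := cf x Ux; rewrite /prop_for /continuous_at -(fg _ Ux).
  by apply: cvg_trans; apply: near_eq_cvg; apply: filterS n => y ->.
have n x : U x -> \near x, f x = g x.
  by move=> Ux; apply: filterS fg _; exact: open_nbhs_nbhs.
move=> [df Df]; split=> [x Ux|v].
  exact: near_eq_differentiable (n _ Ux) (df _ Ux).
by apply: IH (Df v) => x Ux; apply: near_eq_derive; exact: n.
Qed.

Lemma Ck_loc V W k (U : set V) (f : V -> W) :
  (forall x, U x -> exists2 U' : set V, U' x & Ck k U' f) -> Ck k U f.
Proof.
elim: k f => [|k IH] f H; first by move=> x /H[U' U'x]; exact.
split=> [x /H[U' U'x []]|v]; first by move=> + _; apply.
by apply: IH => x /H[U' U'x [_ /(_ v)]]; exists U'.
Qed.

Lemma Ck_sub V W k (U U' : set V) (f : V -> W) :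
  U `<=` U' -> Ck k U' f -> Ck k U f.
Proof. by move=> UU' C; apply: Ck_loc => x /UU'; exists U'. Qed.

Lemma CkS V W k (U : set V) (f : V -> W) : Ck k.+1 U f -> Ck k U f.
Proof.
elim: k f => [|k IH] f /= [df Df].
  by move=> x Ux; apply: differentiable_continuous; exact: df.
by split=> // v; apply: IH; exact: Df.
Qed.

Lemma Ck_cst V W k (U : set V) (c : W) : Ck k U (cst c : V -> W).
Proof.
elim: k c => [|k IH] c /=; first by move=> x _; exact: cst_continuous.
split=> [x _|v]; first exact: differentiable_cst.
by rewrite (_ : 'D_v _ = cst 0) //; apply/funext => x; rewrite derive_cst.
Qed.

Lemma Ck_linear V W k (U : set V) (f : {linear V -> W}) :
  continuous f -> Ck k U f.
Proof.
move=> cf; have df x := linear_differentiable x cf.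
case: k => [|k]; first by move=> x _; exact: cf.
split=> // v; rewrite (_ : 'D_v f = cst (f v)); first exact: Ck_cst.
by apply/funext => x; rewrite deriveE // diff_lin.
Qed.

Lemma CkD V W k (U : set V) (f g : V -> W) :
  open U -> Ck k U f -> Ck k U g -> Ck k U (f + g).
Proof.
move=> oU; elim: k f g => [|k IH] f g.
  by move=> cf cg x Ux; apply: continuousD; [exact: cf|exact: cg].
move=> [df Df] [dg Dg]; split=> [x Ux|v].
  by apply: differentiableD; [exact: df|exact: dg].
apply: (@Ck_ext _ _ _ _ ('D_v f + 'D_v g)) (IH _ _ (Df v) (Dg v)) => // x Ux.
by rewrite deriveD //; apply: diff_derivable; [exact: df|exact: dg].
Qed.

Lemma Ck_sum V W k (U : set V) n (f : 'I_n -> V -> W) :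
  open U -> (forall i, Ck k U (f i)) -> Ck k U (\sum_i f i).
Proof.
move=> oU H; elim/big_ind: _ => // [|g h]; first exact: (Ck_cst k U 0).
exact: CkD.
Qed.

Lemma scaler_bilin W : bilinear_for
    (GRing.Scale.Law.clone _ _ *:%R _) (GRing.Scale.Law.clone _ _ *:%R _)
    (@GRing.scale R W : R^o -> W -> W).
Proof.
split=> [u'|u] a x y /=; first by rewrite scalerDl scalerA.
by rewrite scalerDr !scalerA mulrC.
Qed.

Lemma differentiable_scale V W (a : V -> R^o) (f : V -> W) x :
  differentiable a x -> differentiable f x ->
  differentiable (fun y => a y *: f y) x /\
  forall v, 'd (fun y => a y *: f y) x v = a x *: 'd f x v + 'd a x v *: f x.
Proof.
move=> da df.
pose bM := bilinear_isBilinear.Build R R^o W W _ _ _ (@scaler_bilin W).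
pose b : {bilinear R^o -> W -> W} :=
  HB.pack (@GRing.scale R W : R^o -> W -> W) bM.
have bc : continuous (fun p => b p.1 p.2) by exact: scale_continuous.
have dp := differentiable_pair da df.
have db p := differentiable_bilin p bc.
rewrite (_ : (fun y => _) = (fun p => b p.1 p.2) \o (fun y => (a y, f y))) //.
split; first exact: differentiable_comp.
move=> v; rewrite diff_comp //=.
have -> : 'd (fun p => b p.1 p.2) (a x, f x) =
    (fun q => b (a x) q.2 + b q.1 (f x)) :> (_ -> _) by exact: diff_bilin.
by rewrite diff_pair.
Qed.

Lemma CkZ V W k (U : set V) (a : V -> R^o) (f : V -> W) :
  open U -> Ck k U a -> Ck k U f -> Ck k U (fun x => a x *: f x).
Proof.
move=> oU; elim: k a f => [|k IH] a f.
  by move=> ca cf x Ux; apply: cvgZ; [exact: (ca x Ux)|exact: (cf x Ux)].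
move=> Ca Cf; have [da Da] := Ca; have [df Df] := Cf; split=> [x Ux|v].
  by case: (differentiable_scale (da _ Ux) (df _ Ux)).
apply: (@Ck_ext _ _ _ _
  ((fun x => a x *: 'D_v f x) + (fun x => 'D_v a x *: f x))) => //; last first.
  by apply: CkD => //; [exact: IH (CkS Ca) (Df v)|exact: IH (Da v) (CkS Cf)].
move=> x Ux; have [d E] := differentiable_scale (da _ Ux) (df _ Ux).
by rewrite !fctE (deriveE v d) E (deriveE v (da _ Ux)) (deriveE v (df _ Ux)).
Qed.

Lemma Ck_coord V k (U : set V) n (f : V -> 'rV[R]_n) i :
  open U -> Ck k U f -> Ck k U (fun x => f x 0 i : R^o).
Proof.
move=> oU; elim: k f => [|k IH] f.
  move=> cf x Ux; apply: (@continuous_comp _ _ _ f (fun m : 'rV[R]_n => m 0 i)).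
    exact: cf.
  exact: coord_continuous.
move=> [df Df]; split=> [x Ux|v].
  by apply: (@differentiable_comp _ _ _ _ f (fun m : 'rV[R]_n => m 0 i : R^o));
    [exact: df|exact: differentiable_coord].
apply: Ck_ext (IH _ (Df v)) => // x Ux.
rewrite derive_mx ?mxE //; exact/diff_derivable/df.
Qed.

Lemma derive_sum_basis n W (g : 'rV[R]_n -> W) y (v : 'rV[R]_n) :
  differentiable g y ->
  'd g y v = \sum_i v 0 i *: 'D_(delta_mx 0 i) g y.
Proof.
move=> dg; rewrite {1}(row_sum_delta v) linear_sum.
by apply: eq_bigr => i _; rewrite linearZ deriveE.
Qed.

Lemma Ck_comp V W n k (U : set V) (U' : set 'rV[R]_n) (f : V -> 'rV[R]_n)
    (g : 'rV[R]_n -> W) : open U -> (forall x, U x -> U' (f x)) ->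
  Ck k U f -> Ck k U' g -> Ck k U (g \o f).
Proof.
move=> oU fU; elim: k g => [|k IH] g Cf Cg.
  by move=> x Ux; apply: continuous_comp; [exact: Cf|exact/Cg/fU].
have [df Df] := Cf; have [dg Dg] := Cg.
split=> [x Ux|v].
  by apply: differentiable_comp; [exact: df|exact/dg/fU].
apply: (@Ck_ext _ _ _ _ (\sum_(i < n)
  (fun x => ('D_v f x) 0 i *: ('D_(delta_mx 0 i) g \o f) x))) => //.
  move=> x Ux; rewrite [RHS]deriveE; last first.
    by apply: differentiable_comp; [exact: df|exact/dg/fU].
  rewrite diff_comp; [|exact: df|exact/dg/fU].
  rewrite fct_sumE /= derive_sum_basis; last exact/dg/fU.
  by apply: eq_bigr => i _; rewrite deriveE //; exact: df.
apply: Ck_sum => // i; apply: CkZ => //; first exact: Ck_coord (Df v).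
exact: IH (CkS Cf) (Dg _).
Qed.

End Calculus.

Record chart (R : realType) (T : topologicalType) (d : nat) := Chart {
  cdom : set T;
  ccod : set 'rV[R]_d;
  cfun :> T -> 'rV[R]_d;
  cinv : 'rV[R]_d -> T;
  cdom_open : open cdom;
  ccod_open : open ccod;
  cfun_cod : forall x, cdom x -> ccod (cfun x);
  cinv_dom : forall y, ccod y -> cdom (cinv y);
  cfunK : forall x, cdom x -> cinv (cfun x) = x;
  cinvK : forall y, ccod y -> cfun (cinv y) = y;
  cfun_continuous : forall x, cdom x -> {for x, continuous cfun};
  cinv_continuous : forall y, ccod y -> {for y, continuous cinv} }.
Arguments ccod_open {R T d} c.

Record manifold (R : realType) := Manifold {
  points :> topologicalType;
  points_hausdorff : hausdorff_space points;
  points_second_countable : @second_countable points;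
  mdim : nat;
  atlas_index : Type;
  atlas : atlas_index -> chart R points mdim;
  atlas_cover : forall x, exists i, cdom (atlas i) x;
  atlas_smooth : forall i j,
    smooth_on (ccod (atlas i) `&` cinv (atlas i) @^-1` cdom (atlas j))
              (atlas j \o cinv (atlas i)) }.

Definition chart_at (R : realType) (M : manifold R) (x : M) : atlas_index M :=
  sval (cid (atlas_cover x)).

Lemma chart_atP (R : realType) (M : manifold R) (x : M) :
  cdom (atlas (chart_at x)) x.
Proof. by rewrite /chart_at; case: cid. Qed.

(* Smoothness of F on U, for U open in R^a. *)
Definition smooth_into (R : realType) (M : manifold R) (a : nat)
    (U : set 'rV[R]_a) (F : 'rV[R]_a -> M) : Prop :=
  (forall x, U x -> {for x, continuous F}) /\
  forall j, smooth_on (U `&` F @^-1` cdom (atlas j)) (atlas j \o F).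

Definition smooth_map (R : realType) (M N : manifold R) (f : M -> N) : Prop :=
  forall i, smooth_into (ccod (atlas i)) (f \o cinv (atlas i)).

Section SmoothMaps.
Variable R : realType.
Implicit Types M N P : manifold R.

Lemma open_preim (T T' : topologicalType) (U : set T) (V : set T')
    (F : T -> T') :
  open U -> open V -> (forall x, U x -> {for x, continuous F}) ->
  open (U `&` F @^-1` V).
Proof.
move=> oU oV cF; rewrite openE => x [Ux Vx]; apply: filterI.
  exact: open_nbhs_nbhs.
by apply: (cF x Ux); exact: open_nbhs_nbhs.
Qed.

Lemma smooth_into_ext M a (U : set 'rV[R]_a) (F G : 'rV[R]_a -> M) :
  open U -> (forall x, U x -> F x = G x) -> smooth_into U F -> smooth_into U G.
Proof.
move=> oU FG [cF sF]; split=> [x Ux|j k].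
  have := cF x Ux; rewrite /prop_for /continuous_at -(FG _ Ux).
  apply: cvg_trans; apply: (@near_eq_cvg _ _ (nbhs x)).
  have nU : nbhs x U by exact: open_nbhs_nbhs.
  by apply: filterS nU => y /FG ->.
have := sF j k => /(Ck_ext (open_preim oU (cdom_open _) cF)) H.
have -> : U `&` G @^-1` cdom (atlas j) = U `&` F @^-1` cdom (atlas j).
  by apply/seteqP; split=> x [Ux] /=; rewrite FG.
by apply: H => x [Ux _]; rewrite /= FG.
Qed.

Lemma smooth_into_sub M a (U U' : set 'rV[R]_a) (F : 'rV[R]_a -> M) :
  U `<=` U' -> smooth_into U' F -> smooth_into U F.
Proof.
move=> UU' [cF sF]; split=> [x /UU'|j k]; first exact: cF.
by apply: Ck_sub (sF j k); exact: setSI.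
Qed.

Lemma smooth_into_loc M a (U : set 'rV[R]_a) (F : 'rV[R]_a -> M) :
  (forall x, U x -> exists2 U' : set 'rV[R]_a, U' x & smooth_into U' F) ->
  smooth_into U F.
Proof.
move=> H; split=> [x /H[U' U'x [cF _]]|j k]; first exact: cF.
apply: Ck_loc => x [/H[U' U'x [_ sF]] jx].
by exists (U' `&` F @^-1` cdom (atlas j)) => //; exact: sF.
Qed.

Lemma smooth_into_comp M a b (U : set 'rV[R]_a) (V : set 'rV[R]_b)
    (h : 'rV[R]_a -> 'rV[R]_b) (F : 'rV[R]_b -> M) :
  open U -> (forall x, U x -> V (h x)) ->
  smooth_on U h -> smooth_into V F -> smooth_into U (F \o h).
Proof.
move=> oU UV sh [cF sF].
have ch x : U x -> {for x, continuous h} by exact: (sh 0).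
have cFh x : U x -> {for x, continuous (F \o h)}.
  by move=> Ux; apply: continuous_comp; [exact: ch|exact/cF/UV].
split=> // j k.
apply: (@Ck_comp _ _ _ _ _ _ (V `&` F @^-1` cdom (atlas j)) h (atlas j \o F)).
- exact: open_preim (cdom_open _) cFh.
- by move=> x [Ux jx]; split => //; exact: UV.
- by apply: Ck_sub (sh k) => x [].
- exact: sF.
Qed.

Lemma smooth_map_into M N (f : M -> N) a (U : set 'rV[R]_a)
    (F : 'rV[R]_a -> M) :
  open U -> smooth_map f -> smooth_into U F -> smooth_into U (f \o F).
Proof.
move=> oU sf [cF sF]; apply: smooth_into_loc => x Ux.
set i := chart_at (F x); pose U' := U `&` F @^-1` cdom (atlas i).
have oU' : open U' := open_preim oU (cdom_open _) cF.
exists U'; first by split => //; exact: chart_atP.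
apply: (@smooth_into_ext _ _ _ ((f \o cinv (atlas i)) \o (atlas i \o F))) => //.
  by move=> y [Uy iy]; rewrite /= cfunK.
apply: (@smooth_into_comp _ _ _ _ (ccod (atlas i))) => //.
- by move=> y [Uy iy]; exact: cfun_cod.
- exact: sF.
Qed.

Lemma smooth_map_id M : smooth_map (id : M -> M).
Proof.
by move=> i; split=> [y|j]; [exact: cinv_continuous|exact: atlas_smooth].
Qed.

Lemma smooth_map_comp M N P (f : N -> P) (g : M -> N) :
  smooth_map f -> smooth_map g -> smooth_map (f \o g).
Proof.
move=> sf sg i.
by apply: (smooth_map_into (F := g \o cinv (atlas i))) => //; exact: ccod_open.
Qed.

Lemma smooth_map_continuous M N (f : M -> N) :
  smooth_map f -> continuous f.
Proof.
move=> sf x; set i := chart_at x; have ix : cdom (atlas i) x := chart_atP x.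
have E : \near x, ((f \o cinv (atlas i)) \o atlas i) x = f x.
  have nU : nbhs x (cdom (atlas i)).
    by apply: open_nbhs_nbhs; split=> //; exact: cdom_open.
  apply: filterS nU => y iy.
  by rewrite /= cfunK.
have : {for x, continuous ((f \o cinv (atlas i)) \o atlas i)}.
  apply: continuous_comp; first exact: cfun_continuous.
  by case: (sf i) => cf _; apply: cf; exact: cfun_cod.
rewrite /prop_for /continuous_at (nbhs_singleton E).
apply: cvg_trans; apply: (@near_eq_cvg _ _ (nbhs x)).
by apply: filterS E => y ->.
Qed.

End SmoothMaps.

Definition upd (A : Type) (n : nat) (v : 'I_n -> A) (j : 'I_n) (u : A) :
    'I_n -> A :=
  fun l => if l == j then u else v l.

(* The local expressions, one for each chart, of an n-form; values off the
   image of the chart are irrelevant. *)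
Definition local_form (R : realType) (M : manifold R) (n : nat) :=
  atlas_index M -> 'rV[R]_(mdim M) -> ('I_n -> 'rV[R]_(mdim M)) -> R.

(* f^* w = w, read in every pair of charts.  For f = id it says that the local
   expressions are related by the transition maps. *)
Definition preserved_by (R : realType) (M : manifold R) (n : nat)
    (w : local_form M n) (f : M -> M) : Prop :=
  forall i j x v, cdom (atlas i) x -> cdom (atlas j) (f x) ->
    w j (atlas j (f x))
      (fun l => 'D_(v l) (atlas j \o f \o cinv (atlas i)) (atlas i x)) =
    w i (atlas i x) v.

Record diff_form (R : realType) (M : manifold R) (n : nat) := DiffForm {
  coef : local_form M n;
  coef_linear : forall i y, ccod (atlas i) y -> forall v j a u1 u2,
    coef i y (upd v j (a *: u1 + u2)) =
    a * coef i y (upd v j u1) + coef i y (upd v j u2);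
  coef_alternating : forall i y, ccod (atlas i) y -> forall v j l,
    j != l -> v j = v l -> coef i y v = 0;
  coef_smooth : forall i v,
    smooth_on (ccod (atlas i)) (fun y => coef i y v : R^o);
  coef_compatible : preserved_by coef id }.

(* dw = 0: on constant vector fields the exterior derivative is
   dw(v_0, ..., v_n) = sum_j (-1)^j D_(v_j) w(v_0, ..., omit v_j, ..., v_n). *)
Definition closed_form (R : realType) (M : manifold R) (n : nat)
    (w : diff_form M n) : Prop :=
  forall i y (v : 'I_n.+1 -> 'rV[R]_(mdim M)), ccod (atlas i) y ->
    \sum_(j < n.+1) (-1) ^+ j *
      'D_(v j) (fun z => coef w i z (fun l => v (lift j l)) : R^o) y = 0.

Definition std_simplex (R : realType) (k : nat) : {pred 'rV[R]_k.+1} :=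
  fun t => [forall i, 0 <= t 0 i] && (\sum_i t 0 i == 1).
Arguments std_simplex : clear implicits.

Definition std_face (R : realType) (k : nat) (j : 'I_k.+2) (t : 'rV[R]_k.+1) :
    'rV[R]_k.+2 :=
  \row_i (if unlift j i is Some l then t 0 l else 0).

Lemma std_face_in (R : realType) k j (t : 'rV[R]_k.+1) :
  t \in std_simplex R k -> std_face j t \in std_simplex R k.+1.
Proof.
move=> /andP[/forallP t0 /eqP t1]; apply/andP; split.
  by apply/forallP => i; rewrite mxE; case: unliftP => [l _|_].
apply/eqP; rewrite -t1 (bigD1_ord j) //= mxE unlift_none add0r.
by apply: eq_bigr => l _; rewrite mxE liftK.
Qed.

Lemma vertex_in (R : realType) k : delta_mx 0 0 \in std_simplex R k.
Proof.
apply/andP; split; first by apply/forallP => i; rewrite mxE ler0n.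
rewrite (bigD1 ord0) //= mxE !eqxx big1 ?addr0 // => i i0.
by rewrite mxE (negPf i0).
Qed.

Definition simplex_pt (R : realType) (k : nat) : Type :=
  {t : 'rV[R]_k.+1 | t \in std_simplex R k}.

Definition vertex0 (R : realType) (k : nat) : simplex_pt R k :=
  Sub (delta_mx 0 0) (vertex_in R k).

Definition face_pt (R : realType) (k : nat) (j : 'I_k.+2) (t : simplex_pt R k) :
    simplex_pt R k.+1 :=
  Sub (std_face j (val t)) (std_face_in j (valP t)).

(* A map on the closed simplex is smooth when it extends smoothly to a
   neighbourhood, in R^(k+1), of each of its points. *)
Definition smooth_simplex (R : realType) (M : manifold R) (k : nat)
    (s : simplex_pt R k -> M) : Prop :=
  forall t : simplex_pt R k, exists U (F : 'rV[R]_k.+1 -> M),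
    [/\ open U, U (val t), smooth_into U F &
        forall t' : simplex_pt R k, U (val t') -> F (val t') = s t'].

Record simplex (R : realType) (M : manifold R) (k : nat) := Simplex {
  smap :> simplex_pt R k -> M;
  smapP : smooth_simplex smap }.

HB.instance Definition _ (R : realType) (M : manifold R) k :=
  gen_eqMixin (simplex M k).
HB.instance Definition _ (R : realType) (M : manifold R) k :=
  gen_choiceMixin (simplex M k).

Section SimplexOps.
Variables (R : realType) (M : manifold R).

Lemma cst_smooth k (x : M) : smooth_simplex (fun _ : simplex_pt R k => x).
Proof.
move=> t; exists setT, (fun=> x); split=> //; first exact: openT.
split=> [y _|j l]; first exact: cst_continuous.
exact: (Ck_cst _ _ (atlas j x)).
Qed.

Definition const_simplex k (x : M) : simplex M k := Simplex (cst_smooth x).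

Lemma std_face_linear k (j : 'I_k.+2) : linear (@std_face R k j).
Proof.
move=> a u v; apply/rowP => i; rewrite !mxE.
by case: unliftP => [l _|_]; rewrite ?mxE ?mulr0 ?addr0.
Qed.

Lemma std_face_smooth k (j : 'I_k.+2) U : smooth_on U (@std_face R k j).
Proof.
pose fM := GRing.isLinear.Build _ _ _ _ _ (std_face_linear j).
pose f : {linear _ -> _} := HB.pack (@std_face R k j) fM.
move=> l; apply: (@Ck_linear _ _ _ _ _ f).
have fE : (f : _ -> _) = fun t => \sum_i t 0 i *: f (delta_mx 0 i).
  apply/funext => t; rewrite {1}(row_sum_delta t) linear_sum.
  by apply: eq_bigr => i _; rewrite linearZ.
pose h i (t : 'rV[R]_k.+1) := t 0 i *: f (delta_mx 0 i).
have H : Ck 0 setT (\sum_i h i).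
  apply: Ck_sum => [|i y _]; first exact: openT.
  have c : {for y, continuous (fun t : 'rV[R]_k.+1 => t 0 i : R^o)}.
    exact: coord_continuous.
  exact: (continuousZr_tmp c).
rewrite fE (_ : (fun t => _) = \sum_i h i); first by move=> x; exact: H.
by apply/funext => t; rewrite fct_sumE.
Qed.

Lemma face_smooth k (j : 'I_k.+2) (s : simplex M k.+1) :
  smooth_simplex (fun t => s (face_pt j t)).
Proof.
move=> t; have [U [F [oU Ut sF FE]]] := smapP s (face_pt j t).
have cj : continuous (@std_face R k j).
  by move=> x; apply: (@std_face_smooth k j setT 0).
exists (@std_face R k j @^-1` U), (F \o @std_face R k j); split=> //.
- by apply: open_comp => // x _; exact: cj.
- apply: (smooth_into_comp _ _ _ sF) => //; last exact: std_face_smooth.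
  by apply: open_comp => // x _; exact: cj.
- by move=> t' Ut'; rewrite /= -(FE (face_pt j t')).
Qed.

Definition face k (j : 'I_k.+2) (s : simplex M k.+1) : simplex M k :=
  Simplex (face_smooth j s).

Lemma push_smooth k (f : M -> M) (sf : smooth_map f) (s : simplex M k) :
  smooth_simplex (fun t => f (s t)).
Proof.
move=> t; have [U [F [oU Ut sF FE]]] := smapP s t.
exists U, (f \o F); split=> //; first exact: smooth_map_into.
by move=> t' Ut' /=; rewrite FE.
Qed.

Definition push_simplex k (f : M -> M) (sf : smooth_map f) (s : simplex M k) :
  simplex M k := Simplex (push_smooth sf s).

Lemma simplex_eq k (s s' : simplex M k) : (forall t, s t = s' t) -> s = s'.
Proof.
case: s s' => s p [s' p'] /= /funext E; case: _ / E in p' *.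
by congr Simplex; exact: Prop_irrelevance.
Qed.

End SimplexOps.

(* Iterated integral of h over { u | u_l > 0, sum_l u_l < a }. *)
Fixpoint corner_integral (R : realType) (n : nat) (a : R) :
    ('rV[R]_n -> R) -> R :=
  if n is n'.+1 then fun h =>
    Rintegral lebesgue_measure `]0, a[
      (fun r => corner_integral (a - r)
                  (fun u : 'rV[R]_n' => h (row_mx r%:M u)))
  else fun h => h 0.

Definition barycentric (R : realType) (n : nat) (u : 'rV[R]_n) : 'rV[R]_n.+1 :=
  \row_i (if unlift ord0 i is Some l then u 0 l else 1 - \sum_l u 0 l).

(* Extension by a constant off the simplex; it only serves to write derivatives
   at interior points, along directions tangent to the simplex. *)
Definition simplex_ext (R : realType) (M : manifold R) (k : nat)
    (s : simplex M k) : 'rV[R]_k.+1 -> M :=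
  fun t => s (insubd (vertex0 R k) t).

(* The integral over the simplex of the pullback of w, in the coordinates
   u = (t_1, ..., t_n).  The integrand does not depend on the chart chosen
   at each point, by coef_compatible. *)
Definition form_integral (R : realType) (M : manifold R) (n : nat)
    (w : diff_form M n) (s : simplex M n) : R :=
  corner_integral 1 (fun u : 'rV[R]_n =>
    let t := barycentric u in
    let i := chart_at (simplex_ext s t) in
    coef w i (atlas i (simplex_ext s t))
      (fun l => 'D_(delta_mx 0 (lift ord0 l) - delta_mx 0 ord0)
                  (atlas i \o simplex_ext s) t)).

Definition schain (R : realType) (M : manifold R) (k : nat) :=
  {freeg (simplex M k) / int}.

Definition lin_ext (K : choiceType) (A : zmodType) (f : K -> A)
    (D : {freeg K / int}) : A :=
  \sum_(s <- dom D) f s *~ coeff s D.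

Definition simplex_boundary (R : realType) (M : manifold R) (k : nat)
    (s : simplex M k.+1) : schain M k :=
  \sum_(j < k.+2) << face j s >> *~ (-1) ^+ j.

Definition boundary (R : realType) (M : manifold R) (k : nat)
    (D : schain M k.+1) : schain M k :=
  lin_ext (@simplex_boundary R M k) D.

Definition is_cycle (R : realType) (M : manifold R) (k : nat) :
    schain M k -> Prop :=
  if k is k'.+1 then fun z => boundary z = 0 else fun=> True.

(* H_k(M; Z) = 0. *)
Definition homology_trivial (R : realType) (M : manifold R) (k : nat) : Prop :=
  forall z : schain M k, is_cycle z -> exists w : schain M k.+1, boundary w = z.

(* Hom(C_k(M; Z), A), given by the values on the basis of simplices. *)
Definition scochain (R : realType) (M : manifold R) (k : nat) (A : Type) :=
  simplex M k -> A.

HB.instance Definition _ (R : realType) (M : manifold R) k (A : zmodType) :=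
  GRing.Zmodule.copy (scochain M k A) (simplex M k -> A).

Definition scochain_eval (R : realType) (M : manifold R) (k : nat)
    (A : zmodType) (c : scochain M k A) (D : schain M k) : A := lin_ext c D.

Definition coboundary (R : realType) (M : manifold R) (k : nat) (A : zmodType)
    (c : scochain M k A) : scochain M k.+1 A :=
  fun s => scochain_eval c (boundary << s >>).

Section Diffeomorphisms.
Variables (R : realType) (M : manifold R).
Implicit Types f g : M -> M.

Lemma chart_differentiable f i j (x : M) :
  smooth_map f -> cdom (atlas i) x -> cdom (atlas j) (f x) ->
  differentiable (atlas j \o f \o cinv (atlas i)) (atlas i x).
Proof.
move=> sf ix jx; have [_ /(_ j 1)[+ _]] := sf i; apply; split.
  exact: cfun_cod.
by rewrite /= cfunK.
Qed.

Lemma chart_chain f g i l j (x : M) v :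
  smooth_map f -> smooth_map g ->
  cdom (atlas i) x -> cdom (atlas l) (g x) -> cdom (atlas j) (f (g x)) ->
  'D_v (atlas j \o (f \o g) \o cinv (atlas i)) (atlas i x) =
  'D_('D_v (atlas l \o g \o cinv (atlas i)) (atlas i x))
    (atlas j \o f \o cinv (atlas l)) (atlas l (g x)).
Proof.
move=> sf sg ix lx jx.
have dg := chart_differentiable sg ix lx.
have df := chart_differentiable sf lx jx.
pose P := atlas l \o g \o cinv (atlas i).
pose Q := atlas j \o f \o cinv (atlas l).
have PE : P (atlas i x) = atlas l (g x) by rewrite /P /= cfunK.
rewrite -[RHS]/('D_('D_v P (atlas i x)) Q (atlas l (g x))).
have near_PQ : \forall y \near atlas i x, (Q \o P) y =
    (atlas j \o (f \o g) \o cinv (atlas i)) y.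
  have [cg _] := sg i.
  have oU := open_preim (ccod_open (atlas i)) (cdom_open (atlas l)) cg.
  have Ux : (ccod (atlas i) `&` (g \o cinv (atlas i)) @^-1` cdom (atlas l))
    (atlas i x) by split; [exact: cfun_cod|rewrite /= cfunK].
  have nU := open_nbhs_nbhs (conj oU Ux).
  by apply: filterS nU => y [iy ly]; rewrite /P /Q /= cfunK.
rewrite -(near_eq_derive _ near_PQ).
have dP : differentiable P (atlas i x) := dg.
have dQ : differentiable Q (P (atlas i x)) by rewrite PE; exact: df.
have dQP := differentiable_comp dP dQ.
rewrite (deriveE v dQP) (deriveE v dP) -PE (deriveE _ dQ).
exact: (congr1 (fun h => h v) (diff_comp dP dQ)).
Qed.

Variables (n : nat) (w : diff_form M n).

Lemma preserved_comp f g : smooth_map f -> smooth_map g ->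
  preserved_by (coef w) f -> preserved_by (coef w) g ->
  preserved_by (coef w) (f \o g).
Proof.
move=> sf sg pf pg i j x v ix jx.
have lx := chart_atP (g x); rewrite -(pg _ _ _ v ix lx) -(pf _ _ _ _ lx jx) /=.
by congr (coef w _ _ _); apply/funext => p; exact: chart_chain.
Qed.

Lemma preserved_inv f g : cancel g f -> smooth_map f -> smooth_map g ->
  preserved_by (coef w) f -> preserved_by (coef w) g.
Proof.
move=> gK sf sg pf i j x v ix jx.
have fgx : cdom (atlas i) (f (g x)) by rewrite gK.
rewrite -(pf _ _ _ _ jx fgx) gK; congr (coef w _ _ _); apply/funext => p.
rewrite -(chart_chain _ sf sg ix jx fgx).
rewrite -[RHS](derive_id (atlas i x) (v p)); apply: near_eq_derive.
have nU : nbhs (atlas i x) (ccod (atlas i)).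
  by apply: open_nbhs_nbhs; split; [exact: ccod_open|exact: cfun_cod].
by apply: filterS nU => y iy; rewrite /= gK cinvK.
Qed.

End Diffeomorphisms.

(* The group Diff_w(M). *)
Record Diff (R : realType) (M : manifold R) (n : nat) (w : diff_form M n) :=
    MkDiff {
  dfun :> M -> M;
  dinv : M -> M;
  dfunK : cancel dfun dinv;
  dinvK : cancel dinv dfun;
  dfun_smooth : smooth_map dfun;
  dinv_smooth : smooth_map dinv;
  dfun_preserved : preserved_by (coef w) dfun }.
Arguments dfun_smooth {R M n w} d.
Arguments dinv_smooth {R M n w} d.
Arguments dfun_preserved {R M n w} d.

Section DiffGroup.
Variables (R : realType) (M : manifold R) (n : nat) (w : diff_form M n).
Local Notation Diff := (Diff w).

Lemma Diff_eq (f g : Diff) : (forall x, f x = g x) -> f = g.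
Proof.
case: f g => [f f' fK f'K sf sf' pf] [g g' gK g'K sg sg' pg] /= /funext E.
case: _ / E in gK g'K sg pg *.
have E' : f' = g' by apply/funext => x; rewrite -[in LHS](g'K x) fK.
case: _ / E' in gK g'K sg' *.
by congr MkDiff; exact: Prop_irrelevance.
Qed.

Definition Diff_one : Diff := MkDiff (fun=> erefl) (fun=> erefl)
  (@smooth_map_id R M) (@smooth_map_id R M) (@coef_compatible _ _ _ w).

Definition Diff_inv (f : Diff) : Diff := MkDiff (dinvK f) (dfunK f)
  (dinv_smooth f) (dfun_smooth f)
  (preserved_inv (dinvK f) (dfun_smooth f) (dinv_smooth f) (dfun_preserved f)).

Definition Diff_mul (f g : Diff) : Diff := MkDiff
  (can_comp (dfunK f) (dfunK g)) (can_comp (dinvK g) (dinvK f))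
  (smooth_map_comp (dfun_smooth f) (dfun_smooth g))
  (smooth_map_comp (dinv_smooth g) (dinv_smooth f))
  (preserved_comp (dfun_smooth f) (dfun_smooth g)
     (dfun_preserved f) (dfun_preserved g)).

HB.instance Definition _ := gen_eqMixin Diff.
HB.instance Definition _ := gen_choiceMixin Diff.

Fact Diff_mulA : associative Diff_mul. Proof. by move=> *; exact: Diff_eq. Qed.
Fact Diff_mul1 : left_id Diff_one Diff_mul.
Proof. by move=> *; exact: Diff_eq. Qed.
Fact Diff_mulr1 : right_id Diff_one Diff_mul.
Proof. by move=> *; exact: Diff_eq. Qed.
Fact Diff_mulV : left_inverse Diff_one Diff_inv Diff_mul.
Proof. by move=> f; apply: Diff_eq => x; exact: dfunK. Qed.
Fact Diff_mulrV : right_inverse Diff_one Diff_inv Diff_mul.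
Proof. by move=> f; apply: Diff_eq => x; exact: dinvK. Qed.

HB.instance Definition _ := isGroup.Build Diff
  Diff_mulA Diff_mul1 Diff_mulr1 Diff_mulV Diff_mulrV.

End DiffGroup.

Section GroupCochains.
Variable G : groupType.

Definition gcochain (p : nat) (A : Type) := ('I_p -> G) -> A.

Definition gtail p (g : 'I_p.+1 -> G) : 'I_p -> G := fun j => g (lift ord0 j).

Definition ginit p (g : 'I_p.+1 -> G) : 'I_p -> G :=
  fun j => g (widen_ord (leqnSn p) j).

(* (g_1, ..., g_i g_(i+1), ..., g_(p+1)), with i counted from 0 in 'I_p. *)
Definition gmerge p (i : 'I_p) (g : 'I_p.+1 -> G) : 'I_p -> G := fun j =>
  if (j < i)%N then ginit g j
  else if j == i then (ginit g j * gtail g j)%g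
  else gtail g j.

(* The coboundary for a left, respectively right, action. *)
Definition ldelta (A : zmodType) (act : G -> A -> A) p (c : gcochain p A) :
    gcochain p.+1 A := fun g =>
  act (g ord0) (c (gtail g)) + \sum_(i < p) c (gmerge i g) *~ (-1) ^+ i.+1
  + c (ginit g) *~ (-1) ^+ p.+1.

Definition rdelta (A : zmodType) (act : A -> G -> A) p (c : gcochain p A) :
    gcochain p.+1 A := fun g =>
  c (gtail g) + \sum_(i < p) c (gmerge i g) *~ (-1) ^+ i.+1
  + act (c (ginit g)) (g ord_max) *~ (-1) ^+ p.+1.

Definition gcast p q (e : p = q) (A : Type) (c : gcochain p A) : gcochain q A :=
  fun g => c (fun i => g (cast_ord e i)).

Definition trivial_act (A : Type) (_ : G) (a : A) : A := a.

(* For the trivial action, ldelta and rdelta agree. *)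
Definition gcocycle (A : zmodType) (p : nat) (c : gcochain p A) : Prop :=
  forall g, ldelta (@trivial_act A) c g = 0.

Definition gcohomologous (A : zmodType) (p : nat) (c c' : gcochain p.+1 A) :
    Prop :=
  exists u : gcochain p A, forall g,
    c g - c' g = ldelta (@trivial_act A) u g.

End GroupCochains.

Definition integers (R : realType) : {pred R} := fun x => x \is a Num.int.

Fact integers_zmod_closed (R : realType) : zmod_closed (@integers R).
Proof.
by split=> [|x y xZ yZ]; rewrite unfold_in ?rpred0 //; exact: rpredB.
Qed.

HB.instance Definition _ (R : realType) :=
  GRing.isZmodClosed.Build R (@integers R) (@integers_zmod_closed R).

(* S^1 = R / Z. *)
Definition circle (R : realType) : zmodType := Quotient.quot (@integers R).

Definition mod_Z (R : realType) (x : R) : circle R :=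
  (\pi_(Quotient.quot (@integers R)) x)%qT.

Section Actions.
Variables (R : realType) (M : manifold R) (n : nat) (w : diff_form M n).
Local Notation G := (Diff w).

Definition push (k : nat) (g : G) (D : schain M k) : schain M k :=
  lin_ext (fun s => << push_simplex (dfun_smooth g) s >> : schain M k) D.

Definition pull (k : nat) (A : Type) (c : scochain M k A) (g : G) :
    scochain M k A :=
  fun s => c (push_simplex (dfun_smooth g) s).

Definition gpairing p q k (a : gcochain G p (scochain M k (circle R)))
    (b : gcochain G q (schain M k)) : gcochain G (p + q) (circle R) := fun g =>
  scochain_eval (a (fun i => g (lshift q i))) (b (fun i => g (rshift p i))).

End Actions.

Section Choices.
Variables (R : realType) (M : manifold R) (m : nat) (w : diff_form M m.+1).
Local Notation G := (Diff w).

Definition class_nonzero : Prop :=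
  ~ exists b : scochain M m R, coboundary b = form_integral w.

Definition class_integral : Prop :=
  exists (c : scochain M m.+1 int) (b : scochain M m R),
    coboundary c = 0 /\
    forall s, form_integral w s = (c s)%:~R + coboundary b s.

(* Only the terms of degree at most m.+1 are constrained, and only they occur
   below. *)
Definition Delta_choice (x : M)
    (Delta : forall k, gcochain G k (schain M k)) : Prop :=
  (forall g, Delta 0%N g = << const_simplex 0 x >>) /\
  forall k, (k < m.+1)%N -> forall g,
    ldelta (@push _ _ _ w k) (Delta k) g = boundary (Delta k.+1 g).

(* 'I_(m - m) is empty, so eta m is a single cochain.  The terms eta k with
   m < k are unconstrained and do not occur below. *)
Definition eta_choice
    (eta : forall k, gcochain G (m - k) (scochain M k (circle R))) : Prop :=
  (forall g s, coboundary (eta m g) s = mod_Z (form_integral w s)) /\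
  forall k (hk : (k < m)%N) g,
    rdelta (@pull _ _ _ w k.+1 (circle R)) (eta k.+1) g =
    - (coboundary (gcast (esym (subnSK hk)) (eta k) g)
         *~ (-1) ^+ (m.+1 - k.+1)).

Fact b_degree (k : 'I_m.+1) : ((m - k).+1 + k = m.+1)%N.
Proof. by rewrite addSn subnK // -ltnS. Qed.

Definition b_cochain
    (eta : forall k, gcochain G (m - k) (scochain M k (circle R)))
    (Delta : forall k, gcochain G k (schain M k)) (k : 'I_m.+1) :
    gcochain G m.+1 (circle R) :=
  gcast (b_degree k)
    (gpairing (rdelta (@pull _ _ _ w k (circle R)) (eta k)) (Delta k)).

End Choices.

Arguments Delta_choice {R M m} w x Delta.
Arguments eta_choice {R M m} w eta.

(* Main.v *)
Require Import Defs.
From HB Require Import structures.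
From mathcomp Require Import freeg.
From mathcomp Require Import all_boot all_order all_algebra.
From mathcomp Require Import all_classical all_reals all_analysis.
From mathcomp Require Import zify.
Import Order.TTheory GRing.Theory Num.Theory.
Import numFieldNormedType.Exports.
Set Implicit Arguments.
Unset Strict Implicit.
Unset Printing Implicit Defensive.
Local Open Scope classical_set_scope.
Local Open Scope ring_scope.

(** Write n = m.+1.  The proof rests on one identity.  The pairing of group
    cochains induced by evaluation satisfies the Leibniz rule, and evaluation
    makes the singular coboundary adjoint to the boundary, so that the relation
    delta Delta_k = boundary Delta_(k+1) gives

      delta <eta_k, Delta_k> =
        b_k + (-1)^(n-1-k) <d eta_k, Delta_(k+1)>            (0 <= k <= n-1).

    For k < n-1 the relation between d eta_k and delta eta_(k+1) turns the last
    term into - b_(k+1): consecutive b_k are cohomologous.  For k = n-1 the last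
    term is <j Omega, Delta_n> up to sign, which does not involve eta; hence
    replacing eta by another choice changes b_(n-1) by a coboundary.

    All the cochains delta eta_k take values in singular cocycles.  For k < n-1
    this is delta delta eta_(k+1) = 0, because d commutes with delta; for
    k = n-1 it says that j Omega is invariant under pullback by G, i.e. that the
    integral of Omega over a simplex does not change when the simplex is pushed
    by a diffeomorphism preserving Omega, which is the chain rule at each
    interior point (form_integral_push).  Two things follow.  First, the Leibniz
    rule gives delta b_k = (+/-) <d delta eta_k, Delta_(k+1)> = 0.  Second, b_0
    is delta eta_0 evaluated on the base point; two points x, x' of the
    connected manifold M satisfy x - x' = boundary D for a smooth 1-chain D
    (connected_joined), so b_0 takes the same values for x and x'.  Thus the
    cochain b_0 does not depend on Delta at all.

    The class of b_k is then independent of all choices: move from k to n-1,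
    replace eta there, move to 0, replace Delta there, and move back to k.

    Group cochains are handled as functions of infinite sequences in G that only
    look at a finite initial part.  The entries of a sequence are indexed by nat
    whatever the degree, so that equations between degrees, such as
    (n-1-k) + k = n-1, require no transport of the arguments. *)

(** * Evaluation of singular cochains on chains *)

Section LinExt.
Variables (K : choiceType) (A : zmodType).
Implicit Types (f : K -> A) (D : {freeg K / int}).

(** Identifies lin_ext with the universal extension of a map to a module, from
    which it inherits additivity; zmodule A is A as a module over int. *)
Lemma lin_ext_fglift f D : lin_ext f D = fglift (f : K -> zmodule A) D.
Proof.
pose phi : {additive {freeg K / int} -> zmodule A} :=
  HB.pack (fglift (f : K -> zmodule A))
    (GRing.isZmodMorphism.Build _ _ _ (lift_is_additive (f : K -> zmodule A))).
rewrite -[fglift _ _]/(phi D) -[in RHS](freeg_sumE D) raddf_sum.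
by apply: eq_bigr => s _; rewrite /= liftU.
Qed.

Lemma lin_ext_is_zmod_morphism f : zmod_morphism (lin_ext f).
Proof.
move=> D E; rewrite !lin_ext_fglift.
exact: (lift_is_additive (f : K -> zmodule A)).
Qed.

HB.instance Definition _ f := GRing.isZmodMorphism.Build
  {freeg K / int} A (lin_ext f) (lin_ext_is_zmod_morphism f).

Lemma lin_extU f s : lin_ext f << s >> = f s.
Proof. by rewrite lin_ext_fglift liftU scale1r. Qed.

Lemma lin_ext_funB f f' D : lin_ext (f - f') D = lin_ext f D - lin_ext f' D.
Proof. by rewrite /lin_ext -sumrB; apply: eq_bigr => s _; rewrite -mulrzBl. Qed.

Lemma lin_ext_funMz f (z : int) D : lin_ext (f *~ z) D = lin_ext f D *~ z.
Proof.
pose phi : {additive (K -> A) -> A} := HB.pack (fun f' => lin_ext f' D)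
  (GRing.isZmodMorphism.Build _ _ _ (fun f1 f2 => lin_ext_funB f1 f2 D)).
exact: (raddfMz phi).
Qed.

End LinExt.

Lemma raddf_lin_ext (K : choiceType) (A B : zmodType) (phi : {additive A -> B})
    (f : K -> A) (D : {freeg K / int}) :
  phi (lin_ext f D) = lin_ext (phi \o f) D.
Proof. by rewrite raddf_sum; apply: eq_bigr => s _; rewrite raddfMz. Qed.

Section Evaluation.
Variables (R : realType) (M : manifold R).

Lemma eval_coboundary k (A : zmodType) (c : scochain M k A)
    (D : schain M k.+1) :
  lin_ext (coboundary c) D = lin_ext c (boundary D).
Proof.
rewrite /boundary raddf_lin_ext; apply: eq_bigr => s _; congr (_ *~ _).
by rewrite /coboundary /scochain_eval /boundary lin_extU.
Qed.

Lemma coboundary_is_zmod_morphism k (A : zmodType) :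
  zmod_morphism (@coboundary R M k A).
Proof.
move=> c c'; apply/funext => s.
by rewrite /coboundary /scochain_eval lin_ext_funB.
Qed.

HB.instance Definition _ k (A : zmodType) := GRing.isZmodMorphism.Build
  (scochain M k A) (scochain M k.+1 A) (@coboundary R M k A)
  (@coboundary_is_zmod_morphism k A).

Variables (n : nat) (w : diff_form M n).
Local Notation G := (Diff w).

Lemma eval_pull k (A : zmodType) (c : scochain M k A) (g : G) D :
  lin_ext (pull c g) D = lin_ext c (push g D).
Proof.
rewrite /push raddf_lin_ext; apply: eq_bigr => s _.
by rewrite /= lin_extU.
Qed.

(** Pushing a simplex forward commutes with taking its faces. *)
Lemma coboundary_pull k (A : zmodType) (c : scochain M k A) (g : G) :
  coboundary (pull c g) = pull (coboundary c) g.
Proof.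
apply/funext => s; rewrite /pull /coboundary /scochain_eval eval_pull.
congr (lin_ext c _).
rewrite /boundary /push !lin_extU /simplex_boundary raddf_sum.
apply: eq_bigr => j _; rewrite raddfMz; congr (_ *~ _).
apply: (etrans (lin_extU _ _)).
by congr << _ >>; apply: simplex_eq.
Qed.

Lemma pullM k (A : zmodType) (c : scochain M k A) (g g' : G) :
  pull (pull c g) g' = pull c (g * g')%g.
Proof. by apply/funext => s; congr (c _); exact: simplex_eq. Qed.

End Evaluation.

(** * Group cochains as functions of sequences *)
(** The cancellation behind every d d = 0 in a simplicial setting: the pairs
    (j, i) with i < j are in bijection with the pairs (i, j-1), which have the
    same value and the opposite sign. *)
Lemma simplicial_sum_eq0 (A : zmodType) p (F : nat -> nat -> A) :
  (forall i j, (i < j)%N -> F j i = F i j.-1) ->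
  \sum_(j < p.+2) \sum_(i < p.+1) F j i *~ (-1) ^+ (j + i) = 0.
Proof.
move=> FE.
rewrite (eq_bigr (fun j : 'I_p.+2 =>
    \sum_(i < p.+1 | (i < j)%N) F j i *~ (-1) ^+ (j + i)
  + \sum_(i < p.+1 | (j <= i)%N) F j i *~ (-1) ^+ (j + i))); last first.
  move=> j _; rewrite (bigID (fun i : 'I_p.+1 => (i < j)%N)) /=.
  by congr (_ + _); apply: eq_bigl => i; rewrite -leqNgt.
rewrite big_split /= big_ord_recl big1 // add0r.
rewrite [X in _ + X]big_ord_recr /= [X in _ + (_ + X)]big1 ?addr0; last first.
  by move=> i /leq_trans /(_ (ltnSE (ltn_ord i))); rewrite ltnn.
rewrite [X in _ + X](exchange_big_dep xpredT) //= -big_split big1 //= => j _.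
rewrite -big_split big1 //= => i ij.
by rewrite /bump add1n FE // addSn exprS mulN1r mulrNz addnC addNr.
Qed.

Section Streams.
Variable G : groupType.
Implicit Types (h : nat -> G) (p q : nat).

(** The i-th face of the bar construction, on an infinite sequence: the first
    entry is dropped if i = 0, and the entries number i and i+1 (counted from 1)
    are multiplied if i > 0.  The face that drops the last entry needs no
    separate treatment: on the first p entries, bar_face p.+1 is the identity. *)
Definition bar_face (i : nat) (h : nat -> G) : nat -> G := fun j =>
  if (j.+1 < i)%N then h j
  else if j.+1 == i then (h j * h j.+1)%g
  else h j.+1.

Lemma bar_face_comm i j h : (i < j)%N ->
  bar_face i (bar_face j h) = bar_face j.-1 (bar_face i h).
Proof.
case: j => // j ij; apply/funext => l; rewrite /bar_face /=.
rewrite !ltnS !eqSS.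
by case: (ltngtP l.+1 i) => ?; case: (ltngtP l.+1 j) => ?;
  case: (ltngtP l.+2 i) => ?; case: (ltngtP l.+2 j) => ?;
  case: (ltngtP l j) => ? //=; rewrite ?mulgA //; lia.
Qed.

Lemma bar_face_last p h j : (j < p)%N -> bar_face p.+1 h j = h j.
Proof. by move=> jp; rewrite /bar_face ltnS jp. Qed.

Definition finitary (A : Type) p (C : (nat -> G) -> A) := forall h h',
  (forall i, (i < p)%N -> h i = h' i) -> C h = C h'.

(** With both actions present, the left and the right coboundary are the cases
    where the other action is trivial, and the Leibniz rule can be stated once. *)
Definition bar_delta (A : zmodType) (lact : G -> A -> A) (ract : A -> G -> A) p
    (C : (nat -> G) -> A) : (nat -> G) -> A := fun h =>
  lact (h 0%N) (C (bar_face 0 h))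
  + \sum_(i < p) C (bar_face i.+1 h) *~ (-1) ^+ i.+1
  + ract (C h) (h p) *~ (-1) ^+ p.+1.

Definition trivial_ract (A : Type) (a : A) (_ : G) : A := a.

Lemma mulrz_signS (A : zmodType) (a : A) n :
  a *~ (-1) ^+ n.+1 = - (a *~ (-1) ^+ n).
Proof. by rewrite exprS mulN1r mulrNz. Qed.

Lemma mulrz_sign2 (A : zmodType) (a : A) n : a *~ (-1) ^+ n *~ (-1) ^+ n = a.
Proof. by rewrite -mulrzA -expr2 sqrr_sign. Qed.

Section RightModule.
Variables (A : zmodType) (ract : A -> G -> A).
Hypothesis ract_zmod : forall g, zmod_morphism (ract^~ g).
Hypothesis ractM : forall a g g', ract (ract a g) g' = ract a (g * g')%g.

Let ractA g : {additive A -> A} :=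
  HB.pack (ract^~ g) (GRing.isZmodMorphism.Build A A (ract^~ g) (ract_zmod g)).

Local Notation delta := (bar_delta (@trivial_act G A) ract).

Lemma bar_delta_rightE p C h : delta p C h =
  \sum_(i < p.+1) C (bar_face i h) *~ (-1) ^+ i
  + ract (C h) (h p) *~ (-1) ^+ p.+1.
Proof. by rewrite big_ord_recl. Qed.

Lemma bar_deltaMz p C (z : int) h :
  delta p (fun x => C x *~ z) h = delta p C h *~ z.
Proof.
rewrite /bar_delta !mulrzDl mulrz_suml mulrzAC.
congr (_ + _ + _); last by congr (_ *~ _); exact: (raddfMz (ractA (h p))).
by apply: eq_bigr => i _; rewrite mulrzAC.
Qed.

(** The faces cancel among themselves.  In the terms that involve the action, the
    outer faces of index at most p cancel against the faces inside the outer
    action, and the face of index p+1 cancels against the double action, since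
    it replaces the last two entries by their product. *)
Lemma bar_deltaK p C : finitary p C -> forall h, delta p.+1 (delta p C) h = 0.
Proof.
move=> fC h; rewrite bar_delta_rightE.
under eq_bigr do rewrite bar_delta_rightE mulrzDl mulrz_suml.
rewrite big_split /=.
under eq_bigr do under eq_bigr do rewrite -mulrzA mulrC -exprD.
pose F j i := C (bar_face i (bar_face j h)).
rewrite (@simplicial_sum_eq0 _ p F) => [|i j ij]; last first.
  by rewrite /F bar_face_comm.
rewrite add0r big_ord_recr /=.
have -> : C (bar_face p.+1 h) = C h by apply: fC => i; exact: bar_face_last.
have -> : bar_face p.+1 h p = (h p * h p.+1)%g by rewrite /bar_face ltnn eqxx.
rewrite -ractM -[X in _ + X *~ _]/(ractA (h p.+1) (delta p C h)).
rewrite bar_delta_rightE raddfD raddf_sum raddfMz mulrzDl /=.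
rewrite -addrA [X in _ + X]addrCA.
rewrite !(mulrz_signS _ p.+1) addrN addr0; apply/eqP.
rewrite subr_eq0 mulrz_suml; apply/eqP/eq_bigr => i _.
have -> : bar_face i h p = h p.+1.
  by have := ltn_ord i; rewrite /bar_face; case: ltngtP => //; lia.
by rewrite -[ract (_ *~ _) _]/(ractA _ _) raddfMz mulrzAC.
Qed.

End RightModule.

Section CupProduct.
Variables (A B C : zmodType) (pr : A -> B -> C).
Variables (lact : G -> B -> B) (ract : A -> G -> A).
Hypothesis prl : forall b, zmod_morphism (pr^~ b).
Hypothesis prr : forall a, zmod_morphism (pr a).
Hypothesis pr_act : forall a g b, pr (ract a g) b = pr a (lact g b).

Definition bar_cup p (a : (nat -> G) -> A) (b : (nat -> G) -> B) :
    (nat -> G) -> C :=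
  fun h => pr (a h) (b (fun i => h (p + i)%N)).

Lemma bar_face_low p i h : (i <= p)%N ->
  (fun j => bar_face i h (p + j)%N) = (fun j => h (p.+1 + j)%N).
Proof.
move=> ip; apply/funext => j; rewrite /bar_face ltnNge eqn_leq.
have -> : (i <= (p + j).+1)%N by lia.
by have /negPf -> : ~~ ((p + j).+1 <= i)%N by lia.
Qed.

Lemma bar_face_high p i h :
  (fun j => bar_face (p + i) h (p + j)%N) = bar_face i (fun j => h (p + j)%N).
Proof.
by apply/funext => j; rewrite /bar_face -addnS ltn_add2l eqn_add2l.
Qed.

(** The faces of index at most p act on the argument of a only, and shift that
    of b; the faces of index larger than p act on that of b only.  The two
    terms that this leaves over, the last one of delta a and the first one of
    delta b, cancel because the actions are adjoint for the pairing. *)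
Lemma bar_cup_leibniz p q r a b h : (p + q)%N = r -> finitary p a ->
  bar_delta (@trivial_act G C) (@trivial_ract C) r (bar_cup p a b) h =
  bar_cup p.+1 (bar_delta (@trivial_act G A) ract p a) b h
  + bar_cup p a (bar_delta lact (@trivial_ract B) q b) h *~ (-1) ^+ p.
Proof.
move=> <- fa.
pose L b' : {additive A -> C} :=
  HB.pack (pr^~ b') (GRing.isZmodMorphism.Build A C (pr^~ b') (prl b')).
pose P a' : {additive B -> C} :=
  HB.pack (pr a') (GRing.isZmodMorphism.Build B C (pr a') (prr a')).
have prMzl a' b' k : pr (a' *~ k) b' = pr a' b' *~ k := raddfMz (L b') k a'.
have prMzr a' b' k : pr a' (b' *~ k) = pr a' b' *~ k := raddfMz (P a') k b'.
rewrite /bar_delta /bar_cup /trivial_act /trivial_ract.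
rewrite -[X in _ = X + _]/(L _ _) -[X in _ = _ + X *~ _]/(P _ _).
rewrite !raddfD !raddf_sum big_split_ord /=.
rewrite prMzl prMzr pr_act !mulrzDl addn0 bar_face_low //.
rewrite -!addrA; congr (_ + _); congr (_ + _).
  by apply: eq_bigr => i _; rewrite prMzl bar_face_low.
rewrite -[bar_face 0 _]bar_face_high addn0 bar_face_low //.
rewrite [in RHS]addrA (mulrz_signS _ p) addNr add0r.
rewrite mulrz_suml; congr (_ + _); last first.
  by rewrite -mulrzA mulrC -exprD addnS.
apply: eq_bigr => i _; rewrite prMzr -mulrzA mulrC -exprD addnS.
congr (pr _ _ *~ _).
  apply: fa => j jp; rewrite -addnS /bar_face.
  by have -> : (j.+1 < p + i.+1)%N by lia.
by rewrite -addnS bar_face_high.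
Qed.

End CupProduct.

Section Unroll.
Variable A : zmodType.

Definition unroll p (c : gcochain G p A) : (nat -> G) -> A :=
  fun h => c (fun i => h i).

(** Extends g by 1, so that every tuple is the beginning of a sequence and an
    identity between cochains can be checked on sequences. *)
Definition pad p (g : 'I_p -> G) : nat -> G :=
  fun i => if insub i is Some j then g j else 1%g.

Lemma unroll_pad p (c : gcochain G p A) g : unroll c (pad g) = c g.
Proof. by congr c; apply/funext => i; rewrite /pad valK. Qed.

Lemma unroll_finitary p (c : gcochain G p A) : finitary p (unroll c).
Proof. by move=> h h' hh'; congr c; apply/funext => i; exact: hh'. Qed.

Lemma unroll_ldelta lact p (c : gcochain G p A) h :
  unroll (ldelta lact c) h = bar_delta lact (@trivial_ract A) p (unroll c) h.
Proof. by []. Qed.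

Lemma unroll_rdelta ract p (c : gcochain G p A) h :
  unroll (rdelta ract c) h = bar_delta (@trivial_act G A) ract p (unroll c) h.
Proof. by []. Qed.

End Unroll.
End Streams.

Lemma bar_delta_morph (G : groupType) (A B : zmodType) (phi : {additive A -> B})
    ract ract' p (C : (nat -> G) -> A) h :
  (forall a g, phi (ract a g) = ract' (phi a) g) ->
  phi (bar_delta (@trivial_act G A) ract p C h) =
  bar_delta (@trivial_act G B) ract' p (phi \o C) h.
Proof.
move=> phi_act; rewrite /bar_delta !raddfD raddf_sum raddfMz phi_act.
by congr (_ + _ + _); apply: eq_bigr => i _; rewrite raddfMz.
Qed.

Section Cohomologous.
Variables (G : groupType) (A : zmodType) (p : nat).
Local Notation delta := (ldelta (@trivial_act G A)).

Lemma ldelta_trivB q (u v : gcochain G q A) g :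
  delta (fun x => u x - v x) g = delta u g - delta v g.
Proof.
rewrite /ldelta /trivial_act mulrzBl; under eq_bigr do rewrite mulrzBl.
by rewrite sumrB !opprD [RHS]addrACA; congr (_ + _); rewrite addrACA.
Qed.

Lemma gcohomologous_delta (c c' : gcochain G p.+1 A) (u v : gcochain G p A) :
  (forall h, unroll c h - unroll c' h =
    bar_delta (@trivial_act G A) (@trivial_ract G A) p (unroll u) h
    - bar_delta (@trivial_act G A) (@trivial_ract G A) p (unroll v) h) ->
  gcohomologous c c'.
Proof.
move=> E; exists (fun x => u x - v x) => g.
by rewrite -unroll_pad ldelta_trivB -!(unroll_pad _ g) E.
Qed.

Lemma gcohomologous_refl (c : gcochain G p.+1 A) : gcohomologous c c.
Proof.
by apply: (@gcohomologous_delta _ _ (fun=> 0) (fun=> 0)) => h; rewrite !subrr.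
Qed.

Lemma gcohomologous_sym (c c' : gcochain G p.+1 A) :
  gcohomologous c c' -> gcohomologous c' c.
Proof.
move=> [u uE]; exists (fun x => 0 - u x) => g.
rewrite (ldelta_trivB (fun=> 0)) -uE opprB.
rewrite /ldelta /trivial_act big1 ?mul0rz ?addr0 ?add0r // => i _.
by rewrite mul0rz.
Qed.

Lemma gcohomologous_trans (c c' c'' : gcochain G p.+1 A) :
  gcohomologous c c' -> gcohomologous c' c'' -> gcohomologous c c''.
Proof.
move=> cc' /gcohomologous_sym; move: cc' => [u uE] [v vE].
exists (fun x => u x - v x) => g; rewrite ldelta_trivB -uE -vE.
by rewrite opprB addrA subrK.
Qed.

End Cohomologous.

(** * Invariance of the integral under Omega-preserving diffeomorphisms *)

(** A directional derivative only sees the values along the line.  This matters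
    because simplex_ext is in general not even continuous off the simplex. *)
Lemma near_line_derive (R : realType) (V W : normedModType R) (f g : V -> W)
    x v :
  (\forall h \near (0 : R), f (h *: v + x) = g (h *: v + x)) ->
  'D_v f x = 'D_v g x.
Proof.
move=> fg; have fgx : f x = g x.
  by have := nbhs_singleton fg; rewrite scale0r add0r.
rewrite /derive; congr (lim _).
have E : \forall h \near (0 : R)^',
    h^-1 *: ((f \o shift x) (h *: v) - f x) =
    h^-1 *: ((g \o shift x) (h *: v) - g x).
  by apply: nbhs_dnbhs; apply: filterS fg => h /= ->; rewrite fgx.
rewrite eqEsubset; split; apply: near_eq_cvg => //.
by apply: filterS E => h ->.
Qed.

Lemma near_segment_simplex (R : realType) k (t v : 'rV[R]_k.+1) :
  (forall i, 0 < t 0 i) -> \sum_i t 0 i = 1 -> \sum_i v 0 i = 0 ->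
  \forall h \near (0 : R), h *: v + t \in std_simplex R k.
Proof.
move=> t0 t1 v0.
have : \forall h \near (0 : R), forall i : 'I_k.+1, 0 <= (h *: v + t) 0 i.
  pose nonneg i (h : R) := 0 <= (h *: v + t) 0 i.
  apply: (@filter_forall R _ nonneg (nbhs (0 : R)) _) => i.
  have c : (fun h : R => h * v 0 i + t 0 i) @ 0 --> 0 * v 0 i + t 0 i.
    apply: cvgD; last exact: cvg_cst.
    by apply: cvgM; [exact: cvg_id|exact: cvg_cst].
  have : \forall h \near (0 : R), 0 < h * v 0 i + t 0 i.
    by apply: (cvgr_gt _ c); rewrite mul0r add0r.
  by apply: filterS => h /ltW; rewrite /nonneg !mxE.
apply: filterS => h hp; apply/andP; split; first exact/forallP.
under eq_bigr do rewrite !mxE.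
by rewrite big_split /= -mulr_sumr v0 mulr0 add0r t1.
Qed.

(** The chain rule for g after s.  The extension of s by a constant is replaced
    by a local smooth extension F, with which it agrees along the line through
    t in the direction v; then the usual chain rule applies to F. *)
Lemma derive_simplex_comp (R : realType) (M : manifold R) k (s : simplex M k)
    (g : M -> M) (t : simplex_pt R k) v i j :
  smooth_map g ->
  (\forall h \near (0 : R), h *: v + val t \in std_simplex R k) ->
  cdom (atlas j) (s t) -> cdom (atlas i) (g (s t)) ->
  'D_v (atlas i \o g \o simplex_ext s) (val t) =
  'D_('D_v (atlas j \o simplex_ext s) (val t))
    (atlas i \o g \o cinv (atlas j)) (atlas j (s t)).
Proof.
move=> sg vin jst igst.
have [U [F [oU Ut [cF sF] FE]]] := smapP s t.
have Ft : F (val t) = s t by exact: FE.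
have line_cvg : (fun h : R => h *: v + val t) @ 0 --> val t.
  rewrite -[X in _ --> X]add0r -(scale0r v); apply: cvgD; last exact: cvg_cst.
  by apply: cvgZ; [exact: cvg_id|exact: cvg_cst].
have nU : \forall h \near (0 : R), U (h *: v + val t).
  by apply: line_cvg; exact: open_nbhs_nbhs.
have extF : \forall h \near (0 : R),
    simplex_ext s (h *: v + val t) = F (h *: v + val t).
  apply: filterS2 nU vin => h Uh hin.
  rewrite /simplex_ext -{2}(insubdK (vertex0 R k) hin) FE //.
  by rewrite insubdK.
have line_comp (W : normedModType R) (f : M -> W) :
    'D_v (f \o simplex_ext s) (val t) = 'D_v (f \o F) (val t).
  by apply: near_line_derive; apply: filterS extF => h /= ->.
rewrite (line_comp _ (atlas i \o g)) (line_comp _ (atlas j)).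
pose P := atlas j \o F; pose Q := atlas i \o g \o cinv (atlas j).
have PE : P (val t) = atlas j (s t) by rewrite /P /= Ft.
have dP : differentiable P (val t).
  by have [+ _] := sF j 1; apply; split => //; rewrite /= Ft.
have dQ : differentiable Q (P (val t)) by rewrite PE; exact: chart_differentiable.
rewrite -/P -/Q -PE (deriveE _ dQ) (deriveE _ dP).
have E : \forall y \near val t, (Q \o P) y = (atlas i \o g \o F) y.
  have nj : \forall y \near val t, cdom (atlas j) (F y).
    apply: (cF _ Ut); rewrite Ft; apply: open_nbhs_nbhs.
    by split => //; exact: cdom_open.
  by apply: filterS nj => t' jt'; rewrite /Q /P /= cfunK.
rewrite -[LHS](near_eq_derive _ E) deriveE; last exact: differentiable_comp.
exact: (congr1 (fun h => h v) (diff_comp dP dQ)).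
Qed.

Lemma eq_corner_integral (R : realType) n (a : R) (h h' : 'rV[R]_n -> R) :
  (forall u : 'rV[R]_n, (forall l, 0 < u 0 l) -> \sum_l u 0 l < a ->
    h u = h' u) ->
  0 < a -> corner_integral a h = corner_integral a h'.
Proof.
elim: n a h h' => [|n IH] a h h' E a0 /=.
  by apply: E; [case|rewrite big_ord0].
apply: eq_Rintegral => r; rewrite inE /= in_itv /= => /andP[r0 ra].
apply: IH; last by rewrite subr_gt0.
move=> u u0 ua; apply: E.
  move=> l; rewrite mxE; case: splitP => [j _|j _]; last exact: u0.
  by rewrite ord1 mxE eqxx mulr1n.
rewrite (@big_split_ord _ _ _ 1 n) big_ord1 /=.
rewrite [X in X + _](row_mxEl r%:M u) mxE eqxx mulr1n.
rewrite (eq_bigr (u 0)) => [|l _]; first by rewrite -ltrBrDl.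
exact: (row_mxEr r%:M u).
Qed.

(** The two integrands agree at every point of the open simplex: this is the
    invariance of w under g, read in the charts chosen at s t and at g (s t),
    with the tangent vectors transported by the chain rule. *)
Lemma form_integral_push (R : realType) (M : manifold R) n (w : diff_form M n)
  (g : Diff w) (s : simplex M n) :
  form_integral w (push_simplex (dfun_smooth g) s) = form_integral w s.
Proof.
apply: eq_corner_integral => // u u0 u1.
set t := barycentric u.
have t0 i : 0 < t 0 i.
  by rewrite mxE; case: unliftP => [l _|_]; rewrite ?u0 // subr_gt0.
have t1 : \sum_i t 0 i = 1.
  rewrite big_ord_recl mxE unlift_none [X in _ + X](eq_bigr (u 0)) ?subrK //.
  by move=> l _; rewrite mxE liftK.
have tin : t \in std_simplex R n.
  by apply/andP; split; [apply/forallP => i; exact/ltW|exact/eqP].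
pose t' : simplex_pt R n := Sub t tin.
have tE : t = val t' by rewrite SubK.
have extE : simplex_ext s t = s t' by rewrite /simplex_ext tE valKd.
have pextE : simplex_ext (push_simplex (dfun_smooth g) s) = g \o simplex_ext s.
  by [].
rewrite pextE /= extE.
set i := chart_at (g (s t')); set j := chart_at (s t').
have ji := chart_atP (s t'); have ii := chart_atP (g (s t')).
rewrite -(dfun_preserved g _ _ _ _ ji ii).
congr (coef w i _ _); apply/funext => l; rewrite tE.
apply: derive_simplex_comp => //; first exact: dfun_smooth.
rewrite SubK; apply: near_segment_simplex => //.
have delta1 j' : \sum_i (delta_mx 0 j' : 'rV[R]_n.+1) 0 i = 1.
  rewrite (bigD1 j') //= mxE !eqxx big1 ?addr0 // => i' /negPf i'j.
  by rewrite mxE i'j andbF.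
rewrite -[RHS](subrr 1) -{1}(delta1 (lift ord0 l)) -(delta1 ord0) -sumrB.
by apply: eq_bigr => i' _; rewrite !mxE.
Qed.

(** * Points of a connected manifold are homologous *)
Section Connect.
Variables (R : realType) (M : manifold R).

Definition joined (x y : M) := exists D : schain M 1,
  boundary D = << const_simplex 0 y >> - << const_simplex 0 x >>.

Section Segment.
Variables (i : atlas_index M) (a z : 'rV[R]_(mdim M)).
Let L (t : 'rV[R]_2) : 'rV[R]_(mdim M) := t 0 ord0 *: a + t 0 ord_max *: z.

Lemma segment_smooth_on U : open U -> smooth_on U L.
Proof.
move=> oU k.
have cid : Ck k U (id : 'rV[R]_2 -> 'rV[R]_2).
  by apply: (@Ck_linear _ _ _ _ _ idfun) => x; exact: cvg_id.
have CkT j (b : 'rV[R]_(mdim M)) : Ck k U (fun t : 'rV[R]_2 => t 0 j *: b).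
  by apply: CkZ => //; [exact: (Ck_coord _ oU cid)|exact: Ck_cst].
exact: (CkD oU (CkT ord0 a) (CkT ord_max z)).
Qed.

Lemma segment_smooth :
  (forall t : simplex_pt R 1, ccod (atlas i) (L (val t))) ->
  smooth_simplex (fun t : simplex_pt R 1 => cinv (atlas i) (L (val t))).
Proof.
move=> Lc t; exists (L @^-1` ccod (atlas i)), (cinv (atlas i) \o L).
have oU : open (L @^-1` ccod (atlas i)).
  apply: open_comp => [x _|]; last exact: ccod_open.
  exact: (segment_smooth_on openT 0).
split => //; first exact: Lc.
apply: (smooth_into_comp (V := ccod (atlas i))) => //.
  exact: segment_smooth_on.
exact: (@smooth_map_id R M i).
Qed.

(** Face 0 drops the first vertex, so that it is the end point z. *)
Lemma joined_segment :
  (forall t : simplex_pt R 1, ccod (atlas i) (L (val t))) ->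
  joined (cinv (atlas i) a) (cinv (atlas i) z).
Proof.
move=> Lc; exists << Simplex (segment_smooth Lc) >>.
rewrite /boundary lin_extU /simplex_boundary !big_ord_recl big_ord0 addr0.
rewrite expr0 expr1 mulr1z mulrN1z.
have pt1 (t : simplex_pt R 0) : val t 0 0 = 1.
  by case/andP: (valP t) => _; rewrite big_ord1 => /eqP.
set s := Simplex _.
have -> : face ord0 s = const_simplex 0 (cinv (atlas i) z).
  apply: simplex_eq => t /=; congr (cinv _ _); rewrite /L !mxE.
  case: unliftP => // _; rewrite scale0r add0r.
  case: unliftP => [l _|/(congr1 val)] //.
  by rewrite ord1 pt1 scale1r.
have -> : face (lift ord0 ord0) s = const_simplex 0 (cinv (atlas i) a).
  apply: simplex_eq => t /=; congr (cinv _ _); rewrite /L !mxE.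
  case: unliftP => [l _|/(congr1 val)] //; rewrite ord1 pt1 scale1r.
  case: unliftP => [l' /(congr1 val)|_] //; first by rewrite [l']ord1.
  by rewrite scale0r addr0.
by [].
Qed.

End Segment.

Lemma joined_trans x y z : joined x y -> joined y z -> joined x z.
Proof.
move=> [D DE] [E EE]; exists (D + E).
transitivity (boundary D + boundary E); first exact: (raddfD (lin_ext _)).
by rewrite DE EE addrC addrA subrK.
Qed.

Lemma joined_sym x y : joined x y -> joined y x.
Proof.
move=> [D DE]; exists (- D); rewrite -opprB -DE.
exact: (raddfN (lin_ext _)).
Qed.

(** Balls are convex: the segment from atlas i x to a nearby point stays in the
    ball, hence in the codomain of the chart. *)
Lemma near_joined x : \forall y \near x, joined x y.
Proof.
set i := chart_at x; have ix : cdom (atlas i) x := chart_atP x.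
have : nbhs (atlas i x) (ccod (atlas i)).
  by apply: open_nbhs_nbhs; split; [exact: ccod_open|exact: cfun_cod].
move=> /nbhs_ballP[e e0 eC].
have near_e : \forall y \near x, ball (atlas i x) e (atlas i y).
  by apply: (cfun_continuous ix); exact: nbhsx_ballx.
have near_i : \forall y \near x, cdom (atlas i) y.
  by apply: open_nbhs_nbhs; split => //; exact: cdom_open.
apply: filterS2 near_e near_i => y ye iy.
rewrite -(cfunK ix) -(cfunK iy); apply: joined_segment => t; apply: eC.
move: ye; rewrite -ball_normE /=; apply: le_lt_trans.
have /andP[/forallP tp /eqP] := valP t; rewrite 2!big_ord_recl big_ord0 addr0.
set t0 := val t 0 ord0; rewrite (_ : lift ord0 ord0 = ord_max); last exact: val_inj.
set t1 := val t 0 ord_max => t01.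
have -> : atlas i x - (t0 *: atlas i x + t1 *: atlas i y) =
    t1 *: (atlas i x - atlas i y).
  rewrite -{1}[atlas i x]scale1r -t01 scalerDl scalerBr opprD addrACA subrr.
  by rewrite add0r.
rewrite normrZ ger0_norm ?tp // ler_piMl ?normr_ge0 //.
by rewrite -t01 lerDr tp.
Qed.

(** Being joined to x is an equivalence relation with open classes, so the class
    of x is open and closed. *)
Lemma connected_joined x y : connected [set: M] -> joined x y.
Proof.
move=> /(_ [set z | joined x z]) H.
suff E : [set z | joined x z] = setT by have : setT y by []; rewrite -E.
apply: H.
- exists x; exact: nbhs_singleton (near_joined x).
- exists [set z | joined x z]; last by rewrite setTI.
  rewrite openE => z xz; apply: filterS (near_joined z) => z'; exact: joined_trans.
- exists [set z | joined x z]; last by rewrite setTI.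
  move=> z zcl; have [z' [xz' zz']] := zcl _ (near_joined z).
  exact: joined_trans xz' (joined_sym zz').
Qed.

End Connect.

(** * The cochains b_k *)
Section Transgression.
Variables (R : realType) (M : manifold R) (m : nat) (w : diff_form M m.+1).
Local Notation G := (Diff w).
Local Notation S1 := (circle R).
Local Notation pullS k := (@pull R M _ w k S1).
Local Notation delta0 := (bar_delta (@trivial_act G S1) (@trivial_ract G S1)).
Local Notation deltar k :=
  (bar_delta (@trivial_act G (scochain M k S1)) (pullS k)).
Local Notation deltal k :=
  (bar_delta (@push R M _ w k) (@trivial_ract G (schain M k))).
Local Notation ev k :=
  (fun (c : scochain M k S1) (D : schain M k) => lin_ext c D).

Variable eta : forall k, gcochain G (m - k) (scochain M k S1).
Arguments eta : clear implicits.
Hypothesis etaP : eta_choice w eta.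

Lemma delta_eta k h : (k < m)%N ->
  deltar k.+1 (m - k.+1) (unroll (eta k.+1)) h =
  - (coboundary (unroll (eta k) h) *~ (-1) ^+ (m - k)).
Proof. by move=> hk; exact: etaP.2 hk (fun i => h i). Qed.

Lemma coboundary_eta_top h :
  coboundary (unroll (eta m) h) = (fun s => mod_Z (form_integral w s)).
Proof. by apply/funext => s; exact: etaP.1. Qed.

(** Each delta eta_k takes values in singular cocycles: d delta eta_k is
    delta d eta_k, and d eta_k is a multiple of the coboundary delta eta_(k+1) or,
    in top degree, the invariant cocycle j Omega. *)
Lemma coboundary_delta_eta k h : (k <= m)%N ->
  coboundary (deltar k (m - k) (unroll (eta k)) h) = 0.
Proof.
rewrite (bar_delta_morph _ _ (ract' := pullS k.+1)); last exact: coboundary_pull.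
case: ltngtP => // [km|->] _.
  pose E := deltar k.+1 (m - k.+1) (unroll (eta k.+1)).
  have -> : coboundary (A := S1) \o unroll (eta k) =
      (fun h' => E h' *~ - (-1) ^+ (m - k)).
    apply/funext => h'; rewrite /E delta_eta //.
    by rewrite mulrNz mulNrz opprK mulrz_sign2.
  rewrite bar_deltaMz // -(subnSK km) bar_deltaK ?mul0rz //.
    exact: pullM.
  exact: unroll_finitary.
rewrite (_ : _ \o _ = fun=> (fun s => mod_Z (form_integral w s))); last first.
  by apply/funext => h'; exact: coboundary_eta_top.
rewrite subnn /bar_delta big_ord0 addr0 /trivial_act.
rewrite (_ : pull _ _ = (fun s => mod_Z (form_integral w s))).
  by rewrite expr1 mulrN1z subrr.
by apply/funext => s; rewrite /pull form_integral_push.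
Qed.

Variable Delta : forall k, gcochain G k (schain M k).
Arguments Delta : clear implicits.

Definition transgression (k : 'I_m.+1) : gcochain G m S1 :=
  gcast (subnK (ltnSE (ltn_ord k))) (gpairing (eta k) (Delta k)).

Lemma unroll_b (k : 'I_m.+1) h : unroll (b_cochain eta Delta k) h =
  bar_cup (ev k) (m - k).+1 (deltar k (m - k) (unroll (eta k)))
    (unroll (Delta k)) h.
Proof. by []. Qed.

Variable x : M.
Hypothesis DeltaP : Delta_choice w x Delta.

Lemma delta_Delta k h : (k <= m)%N ->
  deltal k k (unroll (Delta k)) h =
  boundary (unroll (Delta k.+1) h).
Proof. by move=> hk; exact: (DeltaP.2 k hk (fun i => h i)). Qed.

Lemma ev_leibniz k p q r a b h : (p + q)%N = r -> finitary p a ->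
  delta0 r (bar_cup (ev k) p a b) h =
  bar_cup (ev k) p.+1 (deltar k p a) b h
  + bar_cup (ev k) p a (deltal k q b) h *~ (-1) ^+ p.
Proof.
apply: bar_cup_leibniz; first by move=> D c c'; exact: lin_ext_funB.
  by move=> c; exact: raddfB.
by move=> c g D; exact: eval_pull.
Qed.

(** The identity that yields both the comparison of consecutive b_k and, for
    k = m, the independence of eta. *)
Lemma delta_transgression (k : 'I_m.+1) h :
  delta0 m (unroll (transgression k)) h =
  unroll (b_cochain eta Delta k) h
  + lin_ext (coboundary (unroll (eta k) h))
      (unroll (Delta k.+1) (fun i => h (m - k + i)%N)) *~ (-1) ^+ (m - k).
Proof.
have km := ltnSE (ltn_ord k).
apply: etrans (ev_leibniz (unroll (Delta k)) h (subnK km) _) _.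
  exact: unroll_finitary.
by rewrite /bar_cup delta_Delta // eval_coboundary.
Qed.

Lemma b_gcocycle (k : 'I_m.+1) : gcocycle (b_cochain eta Delta k).
Proof.
move=> g; have km := ltnSE (ltn_ord k).
rewrite -unroll_pad unroll_ldelta; set h := pad g.
(* The first factor is again a group cochain, so it is finitary. *)
apply: etrans (ev_leibniz
  (a := unroll (rdelta (pullS k) (eta k))) (unroll (Delta k)) h (b_degree k) _) _.
  exact: unroll_finitary.
rewrite /bar_cup delta_Delta // -eval_coboundary bar_deltaK //; last first.
- exact: unroll_finitary.
- exact: pullM.
rewrite unroll_rdelta coboundary_delta_eta //.
by rewrite /lin_ext !big1 ?mul0rz ?addr0 // => i _; rewrite mul0rz.
Qed.

Lemma b_next (k l : 'I_m.+1) : l = k.+1 :> nat ->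
  gcohomologous (b_cochain eta Delta k) (b_cochain eta Delta l).
Proof.
case: l => l lm /= lk; subst l; have km : (k < m)%N := lm.
apply: (@gcohomologous_delta _ _ _ _ _ (transgression k) (fun=> 0)) => h.
rewrite delta_transgression (_ : delta0 _ _ h = 0); last first.
  by rewrite /bar_delta /unroll big1 ?mul0rz ?addr0 // => i _; rewrite mul0rz.
rewrite subr0; congr (_ + _).
rewrite (unroll_b (Ordinal lm)) /bar_cup delta_eta //.
rewrite subnSK // -mulrNz -[RHS]opprK -mulrNz; congr (- _).
exact: lin_ext_funMz.
Qed.

Lemma b_gcohomologous (k l : 'I_m.+1) :
  gcohomologous (b_cochain eta Delta k) (b_cochain eta Delta l).
Proof.
suff H (j : 'I_m.+1) :
    gcohomologous (b_cochain eta Delta ord0) (b_cochain eta Delta j).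
  by apply: gcohomologous_trans (H l); exact/gcohomologous_sym/H.
case: j => j; elim: j => [|j IH] jm.
  by rewrite (_ : Ordinal jm = ord0); [exact: gcohomologous_refl|exact: val_inj].
exact: gcohomologous_trans (IH (ltnW jm)) (b_next _).
Qed.

End Transgression.

Section Independence.
Variables (R : realType) (M : manifold R) (m : nat) (w : diff_form M m.+1).
Local Notation G := (Diff w).

(** The transgressions of the two choices have coboundaries with the same second
    term, since d eta_m = j Omega in both cases. *)
Lemma b_top_eta x Delta
    (eta eta' : forall k, gcochain G (m - k) (scochain M k (circle R))) :
  Delta_choice w x Delta -> eta_choice w eta -> eta_choice w eta' ->
  gcohomologous (b_cochain eta Delta ord_max) (b_cochain eta' Delta ord_max).
Proof.
move=> DeltaP etaP etaP'.
apply: (@gcohomologous_delta _ _ _ _ _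
  (transgression eta Delta ord_max) (transgression eta' Delta ord_max)) => h.
rewrite !(delta_transgression _ DeltaP) !coboundary_eta_top //.
by rewrite opprD addrACA subrr addr0.
Qed.

(** b_0 is delta eta_0 evaluated on the base point, and a singular cocycle takes
    the same value on homologous points. *)
Lemma b_bottom_Delta x x' Delta Delta'
    (eta : forall k, gcochain G (m - k) (scochain M k (circle R))) :
  connected [set: M] ->
  Delta_choice w x Delta -> Delta_choice w x' Delta' -> eta_choice w eta ->
  b_cochain eta Delta ord0 = b_cochain eta Delta' ord0.
Proof.
move=> Mconn [D0 _] [D0' _] etaP; apply/funext => g; apply/eqP.
have [D DE] := connected_joined x' x Mconn.
rewrite -!unroll_pad !unroll_b /bar_cup /unroll D0 D0' -subr_eq0.
rewrite -(raddfB (lin_ext _)) -DE; apply/eqP.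
apply: etrans (esym (eval_coboundary _ _)) _.
by rewrite coboundary_delta_eta // /lin_ext big1 // => s _; rewrite mul0rz.
Qed.

End Independence.

Theorem proposition2p9 (R : realType) (M : manifold R) (m : nat)
    (Omega : diff_form M m.+1) :
  connected [set: M] ->
  ~ homology_trivial M m.+1 ->
  (forall k, (0 < k < m.+1)%N -> homology_trivial M k) ->
  closed_form Omega ->
  class_nonzero Omega ->
  class_integral Omega ->
  (forall x Delta eta,
     Delta_choice Omega x Delta -> eta_choice Omega eta ->
     (forall k : 'I_m.+1, gcocycle (b_cochain eta Delta k)) /\
     (forall k l : 'I_m.+1,
        gcohomologous (b_cochain eta Delta k) (b_cochain eta Delta l))) /\
  (forall x Delta eta x' Delta' eta',
     Delta_choice Omega x Delta -> eta_choice Omega eta ->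
     Delta_choice Omega x' Delta' -> eta_choice Omega eta' ->
     forall k : 'I_m.+1,
       gcohomologous (b_cochain eta Delta k) (b_cochain eta' Delta' k)).
Proof.
move=> Mconn _ _ _ _ _; split=> [x Delta eta DP eP|].
  by split=> [k|k l]; [exact: b_gcocycle DP k|exact: b_gcohomologous DP k l].
move=> x Delta eta x' Delta' eta' DP eP DP' eP' k.
apply: gcohomologous_trans (b_gcohomologous eP DP k ord_max) _.
apply: gcohomologous_trans (b_top_eta DP eP eP') _.
apply: gcohomologous_trans (b_gcohomologous eP' DP ord_max ord0) _.
rewrite (b_bottom_Delta Mconn DP DP' eP').
exact: (b_gcohomologous eP' DP' ord0 k).
Qed.
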